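(* Let $n$ be a positive integer and let $R$ be a nonzero ring. Then $MC_n(R)$ does not have left Krull dimension.
   Context: All rings are associative with $1$; modules are left unitary modules. The Krull dimension $d_K(M)$ of a left module $M$ is defined recursively (when it exists): $d_K(0)=-\infty$; $d_K(M)=0$ if $M$ is artinian; and, for an ordinal $\alpha$, $d_K(M)=\alpha$ if $d_K(M)\ne\beta$ for every ordinal $\beta<\alpha$ and in any descending chain of submodules of $M$ all but a finite number of factors have Krull dimension less than $\alpha$. A ring has left Krull dimension if it has Krull dimension as a left module over itself. $M_m(R)$ is the ring of $m\times m$ matrices over $R$. Identify $M_n(M_{n^k}(R))$ with $M_{n^{k+1}}(R)$ via block matrices. The $n$-matricial closure $MC_n(R)$ is the direct limit of the rings $M_{n^k}(R)$, $k\in\mathbb{N}=\{0,1,2,\dots\}$ (with $M_{n^0}(R)=R$), along the injective ring morphisms $M_{n^k}(R)\to M_{n^{k+1}}(R)$ sending $A$ to the block diagonal matrix with $n$ diagonal blocks equal to $A$.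
   Formalization: The positive integer n is required to be at least 2: for n = 1 the closure MC_1(R) is R itself, which has left Krull dimension 0 when R is a field, so the claim fails there. *)

(* Defs.v *)
From HB Require Import structures.
From mathcomp Require Import all_boot all_order all_algebra.
From mathcomp Require Import boolp zify.

Set Implicit Arguments.
Unset Strict Implicit.
Unset Printing Implicit Defensive.

Import GRing.Theory.
Local Open Scope ring_scope.
Local Open Scope quotient_scope.

Section Submodule.
Variables (S : pzRingType) (M : lmodType S).

Definition submod (L : submodClosed M) : Type := {x : M | x \in L}.

HB.instance Definition _ (L : submodClosed M) := SubChoice.on (submod L).
HB.instance Definition _ (L : submodClosed M) :=
  [SubChoice_isSubLmodule of submod L by <:].

(* L :&: N, seen as a submodule of L. *)
Definition submod_trace (L N : submodClosed M) : {pred submod L} :=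
  fun x => val x \in N.
Arguments submod_trace : clear implicits.

Lemma submod_traceE (L N : submodClosed M) (x : submod L) :
  (x \in submod_trace L N) = (val x \in N).
Proof. by []. Qed.

Lemma submod_trace_closed (L N : submodClosed M) :
  subsemimod_closed (submod_trace L N).
Proof.
split; first split.
- by rewrite submod_traceE raddf0 rpred0.
- by move=> x y; rewrite !submod_traceE raddfD; apply: rpredD.
- by move=> a x; rewrite !submod_traceE linearZ; apply: rpredZ.
Qed.

HB.instance Definition _ (L N : submodClosed M) :=
  GRing.isSubSemiModClosed.Build S (submod L) (submod_trace L N)
    (submod_trace_closed L N).

End Submodule.

Arguments submod_trace {S M} L N _.

Section QuotientModule.
Variables (S : pzRingType) (M : lmodType S) (N : submodClosed M).

(* The library does not infer that a submodClosed predicate on an lmodType is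
   zmodClosed; this copy of N carries that structure. *)
Definition submod_zmod : {pred M} := fun x => x \in N.

Lemma submod_zmodE x : (x \in submod_zmod) = (x \in N).
Proof. by []. Qed.

Lemma submod_zmod_closed : zmod_closed submod_zmod.
Proof.
split=> [|x y]; rewrite !submod_zmodE ?rpred0 // => Nx Ny.
by rewrite -scaleN1r; apply: rpredD => //; apply: rpredZ.
Qed.

HB.instance Definition _ :=
  GRing.isZmodClosed.Build M submod_zmod submod_zmod_closed.

Definition quotmod : Type := Quotient.quot submod_zmod.

HB.instance Definition _ := GRing.Zmodule.on quotmod.

Definition quotmod_pi (x : M) : quotmod := \pi_(Quotient.quot submod_zmod) x.

Lemma quotmod_pi_eq x y : quotmod_pi x = quotmod_pi y <-> x - y \in N.
Proof.
have -> : (x - y \in N) = (quotmod_pi x == quotmod_pi y).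
  exact: (Quotient.idealrBE submod_zmod).
by split=> [->|/eqP].
Qed.

Lemma quotmod_pi_surj (u : quotmod) : exists x, u = quotmod_pi x.
Proof. by exists (repr u); rewrite /quotmod_pi reprK. Qed.

Lemma quotmod_piD x y : quotmod_pi (x + y) = quotmod_pi x + quotmod_pi y.
Proof. exact: raddfD (\pi_(Quotient.quot submod_zmod)) x y. Qed.

Definition quotmod_scale (a : S) (u : quotmod) : quotmod :=
  quotmod_pi (a *: repr u).

Lemma quotmod_scale_pi a x : quotmod_scale a (quotmod_pi x) = quotmod_pi (a *: x).
Proof.
apply/quotmod_pi_eq; rewrite -scalerBr; apply: rpredZ.
by apply/quotmod_pi_eq; rewrite /quotmod_pi reprK.
Qed.

Lemma quotmod_scaleA a b u :
  quotmod_scale a (quotmod_scale b u) = quotmod_scale (a * b) u.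
Proof. by have [x ->] := quotmod_pi_surj u; rewrite !quotmod_scale_pi scalerA. Qed.

Lemma quotmod_scale1 : left_id 1 quotmod_scale.
Proof. by move=> u; have [x ->] := quotmod_pi_surj u; rewrite quotmod_scale_pi scale1r. Qed.

Lemma quotmod_scaleDr : right_distributive quotmod_scale +%R.
Proof.
move=> a u v; have [x ->] := quotmod_pi_surj u; have [y ->] := quotmod_pi_surj v.
by rewrite -quotmod_piD !quotmod_scale_pi scalerDr quotmod_piD.
Qed.

Lemma quotmod_scaleDl u : {morph quotmod_scale^~ u : a b / a + b}.
Proof.
move=> a b; have [x ->] := quotmod_pi_surj u.
by rewrite !quotmod_scale_pi scalerDl quotmod_piD.
Qed.

HB.instance Definition _ := GRing.Zmodule_isLmodule.Build S quotmod
  quotmod_scaleA quotmod_scale1 quotmod_scaleDr quotmod_scaleDl.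

End QuotientModule.

(* The factor L / N of a chain of submodules, for N contained in L. *)
Definition factor (S : pzRingType) (M : lmodType S) (L N : submodClosed M) :
    lmodType S :=
  quotmod (submod_trace L N).

Section KrullDimension.
Variable S : pzRingType.

Definition zero_module (M : lmodType S) : Prop := forall x : M, x = 0.

Definition descending_chain (M : lmodType S) (N : nat -> submodClosed M) : Prop :=
  forall i, {subset N i.+1 <= N i}.

Definition artinian (M : lmodType S) : Prop :=
  forall N : nat -> submodClosed M, descending_chain N ->
  exists k, forall i, (k <= i)%N -> N i =i N k.

(* An ordinal is represented by a point of a well-ordered type: the order type
   of the set of the points strictly below it. *)
Record wellOrder : Type := WellOrder {
  wo_sort :> Type;
  wo_lt : wo_sort -> wo_sort -> Prop;
  wo_trans : forall a b c, wo_lt a b -> wo_lt b c -> wo_lt a c;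
  wo_total : forall a b, wo_lt a b \/ a = b \/ wo_lt b a;
  wo_wf : well_founded wo_lt
}.

(* One step of the recursion defining d_K(M) = a, where dimK b _ X stands for
   d_K(X) = b, b < a. The zero module is excluded because its dimension is
   -oo; "less than a" below includes -oo. *)
Definition krull_dim_step (W : wellOrder) (a : W)
    (dimK : forall b : W, wo_lt b a -> lmodType S -> Prop) (M : lmodType S) : Prop :=
  ~ zero_module M /\
  ( (~ (exists b : W, wo_lt b a) /\ artinian M)
  \/
    [/\ exists b : W, wo_lt b a,
        forall (b : W) (ltba : wo_lt b a), ~ dimK b ltba M &
        forall N : nat -> submodClosed M, descending_chain N ->
        exists k, forall i, (k <= i)%N ->
          zero_module (factor (N i) (N i.+1)) \/
          exists (b : W) (ltba : wo_lt b a), dimK b ltba (factor (N i) (N i.+1))]).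

(* d_K(M) = a *)
Definition krull_dim_is (W : wellOrder) : W -> lmodType S -> Prop :=
  Fix (@wo_wf W) (fun _ => lmodType S -> Prop) (@krull_dim_step W).

Lemma krull_dim_isE (W : wellOrder) (a : W) (M : lmodType S) :
  krull_dim_is a M = krull_dim_step (fun (b : W) (_ : wo_lt b a) => krull_dim_is b) M.
Proof.
rewrite /krull_dim_is Fix_eq // => x f g fg; congr krull_dim_step.
by apply: functional_extensionality_dep => b; apply: functional_extensionality_dep.
Qed.

Definition has_krull_dim (M : lmodType S) : Prop :=
  zero_module M \/ exists (W : wellOrder) (a : W), krull_dim_is a M.

End KrullDimension.

Definition has_left_krull_dim (S : pzRingType) : Prop :=
  has_krull_dim (S^o : lmodType S).

Section DirectLimit.
Variables (A : nat -> pzRingType) (f : forall k, {rmorphism A k -> A k.+1}).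

Definition dirlim_step (x : {k & A k}) : {k & A k} :=
  Tagged A (f (tag x) (tagged x)).

Definition dirlim_eq (x y : {k & A k}) : bool :=
  `[< exists d e, iter d dirlim_step x = iter e dirlim_step y >].

Lemma dirlim_eq_equiv : equiv_class_of dirlim_eq.
Proof.
split=> [x|x y|y x z].
- by apply/asboolP; exists 0%N, 0%N.
- by apply/idP/idP => /asboolP[d [e E]]; apply/asboolP; exists e, d.
- move=> /asboolP[d [e E]] /asboolP[d' [e' E']]; apply/asboolP.
  exists (d' + d)%N, (e + e')%N.
  by rewrite iterD E -iterD addnC iterD E' -iterD.
Qed.

Canonical dirlim_equiv := EquivRelPack dirlim_eq_equiv.
Canonical dirlim_encModRel := defaultEncModRel dirlim_eq.

(* The direct limit of A 0 -> A 1 -> A 2 -> ... along f. *)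
Definition dirlim : Type := {eq_quot dirlim_eq}.

HB.instance Definition _ := Choice.on dirlim.
HB.instance Definition _ : EqQuotient _ dirlim_eq dirlim := EqQuotient.on dirlim.

Definition dirlim_in k (a : A k) : dirlim := \pi_dirlim (Tagged A a).

Lemma dirlim_inP k l (a : A k) (b : A l) :
  dirlim_in a = dirlim_in b <->
  exists d e, iter d dirlim_step (Tagged A a) = iter e dirlim_step (Tagged A b).
Proof.
by split=> [/eqP|E]; [|apply/eqP]; rewrite piE; [move/asboolP|apply/asboolP].
Qed.

(* Both arguments are pushed to the common level tag x + tag y, where op is
   applied; tagged_as is only a cast between these two equal levels. *)
Definition dirlim_op (op : forall k, A k -> A k -> A k) (x y : dirlim) : dirlim :=
  let u := iter (tag (repr y)) dirlim_step (repr x) in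
  let v := iter (tag (repr x)) dirlim_step (repr y) in
  dirlim_in (op (tag u) (tagged u) (tagged_as u v)).

Definition dirlim_zero : dirlim := dirlim_in (0 : A 0).
Definition dirlim_one : dirlim := dirlim_in (1 : A 0).
Definition dirlim_opp (x : dirlim) : dirlim := dirlim_in (- tagged (repr x)).
Definition dirlim_add : dirlim -> dirlim -> dirlim :=
  dirlim_op (fun k (a b : A k) => a + b).
Definition dirlim_mul : dirlim -> dirlim -> dirlim :=
  dirlim_op (fun k (a b : A k) => a * b).

Fixpoint dirlim_trans k d : A k -> A (d + k) :=
  if d is d'.+1 then fun a => f _ (dirlim_trans d' a) else id.

Lemma iter_dirlim_step k d (a : A k) :
  iter d dirlim_step (Tagged A a) = Tagged A (dirlim_trans d a).
Proof. by elim: d => //= d ->. Qed.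

Lemma dirlim_in_trans k d (a : A k) : dirlim_in (dirlim_trans d a) = dirlim_in a.
Proof. by apply/dirlim_inP; exists 0%N, d; rewrite [RHS]iter_dirlim_step. Qed.

Lemma dirlim_in_step k (a : A k) : dirlim_in (f k a) = dirlim_in a.
Proof. exact: (dirlim_in_trans 1 a). Qed.

Lemma dirlim_in_tagged (x : {k & A k}) : dirlim_in (tagged x) = \pi_dirlim x.
Proof. by case: x. Qed.

Lemma tag_iter_dirlim d x : tag (iter d dirlim_step x) = (d + tag x)%N.
Proof. by elim: d => //= d ->. Qed.

Lemma pi_iter_dirlim d x : \pi_dirlim (iter d dirlim_step x) = \pi_dirlim x.
Proof. by case: x => k a; rewrite iter_dirlim_step; apply: dirlim_in_trans. Qed.

Lemma dirlim_lift (x : dirlim) : exists k (a : A k), x = dirlim_in a.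
Proof. by exists (tag (repr x)), (tagged (repr x)); rewrite dirlim_in_tagged reprK. Qed.

Lemma dirlim_raise m k (a : A k) :
  (k <= m)%N -> exists b : A m, dirlim_in a = dirlim_in b.
Proof.
move=> le_km; rewrite -(subnK le_km).
by exists (dirlim_trans (m - k) a); rewrite dirlim_in_trans.
Qed.

Lemma dirlim_lift2 (x y : dirlim) :
  exists k (a b : A k), x = dirlim_in a /\ y = dirlim_in b.
Proof.
have [k [a ->]] := dirlim_lift x; have [l [b ->]] := dirlim_lift y.
have [a' Ea] := dirlim_raise a (leq_addr l k).
have [b' Eb] := dirlim_raise b (leq_addl k l).
by exists (k + l)%N, a', b'.
Qed.

Lemma dirlim_lift3 (x y z : dirlim) :
  exists k (a b c : A k), [/\ x = dirlim_in a, y = dirlim_in b & z = dirlim_in c].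
Proof.
have [k [a [b [-> ->]]]] := dirlim_lift2 x y; have [l [c ->]] := dirlim_lift z.
have [a' Ea] := dirlim_raise a (leq_addr l k).
have [b' Eb] := dirlim_raise b (leq_addr l k).
have [c' Ec] := dirlim_raise c (leq_addl k l).
by exists (k + l)%N, a', b', c'.
Qed.

Lemma Tagged_op (op : forall k, A k -> A k -> A k) k l (a b : A k) (a' b' : A l) :
  Tagged A a = Tagged A a' -> Tagged A b = Tagged A b' ->
  Tagged A (op k a b) = Tagged A (op l a' b').
Proof.
move=> Ea; have kl : k = l := congr1 tag Ea.
by case: l / kl a' b' Ea => a' b' /eqP; rewrite eq_Tagged => /eqP /= -> /eqP; rewrite eq_Tagged => /eqP /= ->.
Qed.

Lemma dirlim_opE (op : forall k, A k -> A k -> A k) :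
    (forall k (a b : A k), f k (op k a b) = op _ (f k a) (f k b)) ->
  forall k (a b : A k), dirlim_op op (dirlim_in a) (dirlim_in b) = dirlim_in (op k a b).
Proof.
move=> fop k a b; rewrite /dirlim_op.
have transop m d (c e : A m) :
    dirlim_trans d (op m c e) = op _ (dirlim_trans d c) (dirlim_trans d e).
  by elim: d => //= d ->; rewrite fop.
set x := repr (dirlim_in a); set y := repr (dirlim_in b).
have [d1 [e1 Ex]] : exists d e, iter d dirlim_step x = iter e dirlim_step (Tagged A a).
  by apply/asboolP; have /eqP := reprK (dirlim_in a); rewrite piE.
have [d2 [e2 Ey]] : exists d e, iter d dirlim_step y = iter e dirlim_step (Tagged A b).
  by apply/asboolP; have /eqP := reprK (dirlim_in b); rewrite piE.
have t1 : (d1 + tag x = e1 + k)%N by have := congr1 tag Ex; rewrite !tag_iter_dirlim.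
have t2 : (d2 + tag y = e2 + k)%N by have := congr1 tag Ey; rewrite !tag_iter_dirlim.
set u := iter (tag y) _ x; set v := iter (tag x) _ y.
have tuv : tag u = tag v by rewrite !tag_iter_dirlim addnC.
have Ev : v = Tagged A (tagged_as u v).
  move: tuv; case: (u) (v) => m p [m' q] /= mm'.
  by case: m' / mm' q => q; rewrite tagged_asE.
have Eu : u = Tagged A (tagged u) by case: (u).
apply/dirlim_inP; exists (d1 + d2)%N, (e1 + d2 + tag y)%N.
rewrite !iter_dirlim_step !transop; apply: Tagged_op; rewrite -!iter_dirlim_step.
- rewrite -Eu -!iterD.
  by rewrite -addnA addnC iterD Ex -iterD; congr iter; lia.
- rewrite -Ev -!iterD.
  have -> : (d1 + d2 + tag x = (d1 + tag x) + d2)%N by lia.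
  by rewrite iterD Ey -iterD; congr iter; lia.
Qed.

Lemma dirlim_inD k (a b : A k) :
  dirlim_add (dirlim_in a) (dirlim_in b) = dirlim_in (a + b).
Proof. by apply: dirlim_opE => *; rewrite rmorphD. Qed.

Lemma dirlim_inM k (a b : A k) :
  dirlim_mul (dirlim_in a) (dirlim_in b) = dirlim_in (a * b).
Proof. by apply: dirlim_opE => *; rewrite rmorphM. Qed.

Lemma dirlim_inN k (a : A k) : dirlim_opp (dirlim_in a) = dirlim_in (- a).
Proof.
have [d [e Ex]] :
    exists d e, iter d dirlim_step (repr (dirlim_in a)) = iter e dirlim_step (Tagged A a).
  by apply/asboolP; have /eqP := reprK (dirlim_in a); rewrite piE.
apply/dirlim_inP; exists d, e.
have transN m c (b : A m) : dirlim_trans c (- b) = - dirlim_trans c b.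
  by elim: c => //= c ->; rewrite rmorphN.
case: (repr _) Ex => l b; rewrite !iter_dirlim_step !transN => Eab.
exact: (Tagged_op (fun m (c _ : A m) => - c) Eab Eab).
Qed.

Lemma dirlim_in0 k : dirlim_in (0 : A k) = dirlim_zero.
Proof.
elim: k => // k <-; rewrite -[RHS]dirlim_in_step; congr dirlim_in.
by rewrite rmorph0.
Qed.

Lemma dirlim_in1 k : dirlim_in (1 : A k) = dirlim_one.
Proof.
elim: k => // k <-; rewrite -[RHS]dirlim_in_step; congr dirlim_in.
by rewrite rmorph1.
Qed.

Lemma dirlim_addA : associative dirlim_add.
Proof.
move=> x y z; have [k [a [b [c [-> -> ->]]]]] := dirlim_lift3 x y z.
by rewrite !dirlim_inD addrA.
Qed.

Lemma dirlim_addC : commutative dirlim_add.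
Proof.
move=> x y; have [k [a [b [-> ->]]]] := dirlim_lift2 x y.
by rewrite !dirlim_inD addrC.
Qed.

Lemma dirlim_add0 : left_id dirlim_zero dirlim_add.
Proof.
by move=> x; have [k [a ->]] := dirlim_lift x; rewrite -(dirlim_in0 k) dirlim_inD add0r.
Qed.

Lemma dirlim_addN : left_inverse dirlim_zero dirlim_opp dirlim_add.
Proof.
move=> x; have [k [a ->]] := dirlim_lift x.
by rewrite -(dirlim_in0 k) dirlim_inN dirlim_inD addNr.
Qed.

Lemma dirlim_mulA : associative dirlim_mul.
Proof.
move=> x y z; have [k [a [b [c [-> -> ->]]]]] := dirlim_lift3 x y z.
by rewrite !dirlim_inM mulrA.
Qed.

Lemma dirlim_mul1l : left_id dirlim_one dirlim_mul.
Proof.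
by move=> x; have [k [a ->]] := dirlim_lift x; rewrite -(dirlim_in1 k) dirlim_inM mul1r.
Qed.

Lemma dirlim_mul1r : right_id dirlim_one dirlim_mul.
Proof.
by move=> x; have [k [a ->]] := dirlim_lift x; rewrite -(dirlim_in1 k) dirlim_inM mulr1.
Qed.

Lemma dirlim_mulDl : left_distributive dirlim_mul dirlim_add.
Proof.
move=> x y z; have [k [a [b [c [-> -> ->]]]]] := dirlim_lift3 x y z.
by rewrite !(dirlim_inM, dirlim_inD) mulrDl.
Qed.

Lemma dirlim_mulDr : right_distributive dirlim_mul dirlim_add.
Proof.
move=> x y z; have [k [a [b [c [-> -> ->]]]]] := dirlim_lift3 x y z.
by rewrite !(dirlim_inM, dirlim_inD) mulrDr.
Qed.

HB.instance Definition _ := GRing.isPzRing.Build dirlim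
  dirlim_addA dirlim_addC dirlim_add0 dirlim_addN
  dirlim_mulA dirlim_mul1l dirlim_mul1r dirlim_mulDl dirlim_mulDr.

Lemma dirlim_in_is_zmod_morphism k : zmod_morphism (@dirlim_in k).
Proof. by move=> a b; rewrite -dirlim_inD -dirlim_inN. Qed.

Lemma dirlim_in_is_monoid_morphism k : monoid_morphism (@dirlim_in k).
Proof. by split=> [|a b]; [exact: dirlim_in1 | rewrite -dirlim_inM]. Qed.

HB.instance Definition _ k :=
  GRing.isZmodMorphism.Build (A k) dirlim (@dirlim_in k)
    (@dirlim_in_is_zmod_morphism k).
HB.instance Definition _ k :=
  GRing.isMonoidMorphism.Build (A k) dirlim (@dirlim_in k)
    (@dirlim_in_is_monoid_morphism k).

End DirectLimit.

Section MatricialClosure.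
Variables (n : nat) (R : pzRingType).

Lemma sum_block_size k : (\sum_(i < n) n ^ k)%N = (n ^ k.+1)%N.
Proof. by rewrite sum_nat_const card_ord expnS. Qed.

(* A |-> diag(A, ..., A), with n blocks *)
Definition diag_embed k (A : 'M[R]_(n ^ k)) : 'M[R]_(n ^ k.+1) :=
  castmx (sum_block_size k, sum_block_size k) (\mxdiag_(i < n) A).

Lemma diag_embed_is_zmod_morphism k : zmod_morphism (@diag_embed k).
Proof.
move=> A B; rewrite /diag_embed.
rewrite mxdiagB; move: (sum_block_size k) => e.
by case: _ / e; rewrite !castmx_id.
Qed.

Lemma diag_embed_is_monoid_morphism k : monoid_morphism (@diag_embed k).
Proof.
rewrite /diag_embed; move: (sum_block_size k) => e; split=> [|A B].
  by rewrite mxdiagZ; case: _ / e; rewrite castmx_id.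
have -> : \mxdiag_(i < n) (A * B) = (\mxdiag_(i < n) A) *m (\mxdiag_(i < n) B).
  rewrite {3}/mxdiag mul_mxdiag_mxblock; apply/eq_mxblock => i j.
  by case: eqP => _; rewrite ?conform_mx_id ?mulmx0.
by case: _ / e; rewrite !castmx_id.
Qed.

HB.instance Definition _ k :=
  GRing.isZmodMorphism.Build 'M[R]_(n ^ k) 'M[R]_(n ^ k.+1) (@diag_embed k)
    (@diag_embed_is_zmod_morphism k).
HB.instance Definition _ k :=
  GRing.isMonoidMorphism.Build 'M[R]_(n ^ k) 'M[R]_(n ^ k.+1) (@diag_embed k)
    (@diag_embed_is_monoid_morphism k).

(* The n-matricial closure of R; its level 0 is 'M[R]_1, i.e. R. *)
Definition matricial_closure : pzRingType :=
  dirlim (fun k => diag_embed (k := k) : {rmorphism 'M[R]_(n ^ k) -> 'M[R]_(n ^ k.+1)}).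

End MatricialClosure.

(* Main.v *)
(** A module with Krull dimension has finite uniform dimension, whereas the
    matrix units E_k in the top left corner of 'M_(n ^ k) become, in the limit,
    a strictly decreasing sequence of commuting idempotents, whose successive
    differences generate an infinite direct sum of left ideals.

    Infinite direct sums are replaced by dual systems: vectors x_i and
    submodules K_i such that x_j lies in K_i exactly when j <> i.  If L_j is the
    intersection of the K_i for i not divisible by 2 ^ j, then each factor
    L_j / L_(j+1) inherits a dual system from the x_i with
    i = 2 ^ j * (2 * m + 1), so well-founded induction on the dimension excludes
    dual systems in a module with Krull dimension. *)
Require Import Defs.
From HB Require Import structures.
From mathcomp Require Import all_boot all_order all_algebra.
From mathcomp Require Import boolp zify.

Set Implicit Arguments.
Unset Strict Implicit.
Unset Printing Implicit Defensive.

Import GRing.Theory.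
Local Open Scope ring_scope.

(** * Intersections of submodules and their images in a quotient *)

Section Submodules.
Variables (S : pzRingType) (M : lmodType S).
Implicit Types K N : submodClosed M.

Definition bigcap_submod (I : Type) (K : I -> submodClosed M) (P : I -> Prop) :
  {pred M} := fun z => `[< forall i, P i -> z \in K i >].

Lemma bigcap_submodP I (K : I -> submodClosed M) (P : I -> Prop) z :
  reflect (forall i, P i -> z \in K i) (z \in bigcap_submod K P).
Proof. exact: asboolP. Qed.

Lemma bigcap_submod_closed I (K : I -> submodClosed M) (P : I -> Prop) :
  subsemimod_closed (bigcap_submod K P).
Proof.
split; first split.
- by apply/bigcap_submodP => i _; apply: rpred0.
- move=> y z /bigcap_submodP Ky /bigcap_submodP Kz.
  by apply/bigcap_submodP => i Pi; apply: rpredD; [apply: Ky | apply: Kz].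
- move=> a z /bigcap_submodP Kz.
  by apply/bigcap_submodP => i Pi; apply: rpredZ; apply: Kz.
Qed.

HB.instance Definition _ I (K : I -> submodClosed M) (P : I -> Prop) :=
  GRing.isSubSemiModClosed.Build S M (bigcap_submod K P)
    (bigcap_submod_closed K P).

Definition quot_submod N K : {pred quotmod N} :=
  fun u => `[< exists2 x, x \in K & u = quotmod_pi N x >].
Arguments quot_submod : clear implicits.

Lemma quot_submodP N K u :
  reflect (exists2 x, x \in K & u = quotmod_pi N x) (u \in quot_submod N K).
Proof. exact: asboolP. Qed.

(** Representatives of one class differ by an element of [N], hence of [K]. *)
Lemma quot_submod_pi N K (sNK : {subset N <= K}) x :
  (quotmod_pi N x \in quot_submod N K) = (x \in K).
Proof.
apply/quot_submodP/idP => [[y Ky /quotmod_pi_eq Nxy]|]; last by exists x.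
by rewrite -(subrK y x); apply: rpredD => //; apply: sNK.
Qed.

Lemma quot_submod_closed N K : subsemimod_closed (quot_submod N K).
Proof.
split; first split.
- apply/quot_submodP; exists 0; first exact: rpred0.
  by apply: (addrI (quotmod_pi N 0)); rewrite -quotmod_piD !addr0.
- move=> u v /quot_submodP[x Kx ->] /quot_submodP[y Ky ->].
  by apply/quot_submodP; exists (x + y); rewrite ?quotmod_piD ?rpredD.
- move=> a u /quot_submodP[x Kx ->]; apply/quot_submodP.
  by exists (a *: x); [apply: rpredZ | apply: quotmod_scale_pi].
Qed.

HB.instance Definition _ N K :=
  GRing.isSubSemiModClosed.Build S (quotmod N) (quot_submod N K)
    (quot_submod_closed N K).

End Submodules.

Arguments quot_submod {S M} N K _.

(** * Dual systems against Krull dimension *)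

Definition dual_system (S : pzRingType) (M : lmodType S)
    (x : nat -> M) (K : nat -> submodClosed M) : Prop :=
  forall i j, (x j \in K i) = (j != i).

Section DualSystem.
Variable S : pzRingType.

Lemma dual_system_nonzero (M : lmodType S) (x : nat -> M) K :
  dual_system x K -> ~ zero_module M.
Proof. by move=> xK M0; have := xK 0 0; rewrite (M0 (x 0)) rpred0 eqxx. Qed.

Section Chain.
Variables (M : lmodType S) (x : nat -> M) (K : nat -> submodClosed M).
Hypothesis xK : dual_system x K.

Definition dyadic_cap (j : nat) : submodClosed M :=
  bigcap_submod K (fun i => ~~ (2 ^ j %| i)%N).

(** Only [K i] excludes [x i], so what matters is whether [K i] is among the submodules
    intersected. *)
Lemma mem_dyadic_cap i j : (x i \in dyadic_cap j) = (2 ^ j %| i)%N.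
Proof.
apply/bigcap_submodP/idP => [xiK|dvd_i m ndvd_m].
  by apply/negPn/negP => /xiK; rewrite xK eqxx.
by rewrite xK; apply: contraNneq ndvd_m => <-.
Qed.

Lemma dyadic_cap_chain : descending_chain dyadic_cap.
Proof.
move=> j z /bigcap_submodP zK; apply/bigcap_submodP => i ndvd_i; apply: zK.
by apply: contra ndvd_i; apply: dvdn_trans; rewrite expnS dvdn_mull.
Qed.

Lemma dual_system_not_artinian : ~ artinian M.
Proof.
move=> artM; have [k stab] := artM dyadic_cap dyadic_cap_chain.
(* [x (2 ^ k)] lies in stage [k] but not in stage [k.+1]. *)
have := stab k.+1 (leqnSn k) (x (2 ^ k)).
by rewrite !mem_dyadic_cap dvdnn dvdn_Pexp2l ?ltnn.
Qed.

Lemma dual_system_factor j :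
  exists y K', @dual_system S (factor (dyadic_cap j) (dyadic_cap j.+1)) y K'.
Proof.
set L := dyadic_cap j; set N := dyadic_cap j.+1.
(* Odd multiples of [2 ^ j]: the factor [2 ^ j] puts [x (idx m)] in [L], and oddness makes
   [K (idx m)] one of the submodules intersected in [N], so that membership in it can be tested
   modulo [N]. *)
pose idx m := (2 ^ j * (2 * m).+1)%N.
have idx_ndvd m : ~~ (2 ^ j.+1 %| idx m)%N.
  by rewrite expnSr dvdn_pmul2l ?expn_gt0 // dvdn2 /= oddM.
have xL m : x (idx m) \in L by rewrite mem_dyadic_cap dvdn_mulr.
have sub_trace m : {subset submod_trace L N <= submod_trace L (K (idx m))}.
  by move=> z; rewrite !submod_traceE => /bigcap_submodP; apply.
exists (fun m => quotmod_pi (submod_trace L N) (Sub (x (idx m)) (xL m))).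
pose K' m : submodClosed (factor L N) :=
  quot_submod (submod_trace L N) (submod_trace L (K (idx m))).
exists K' => i m.
rewrite (quot_submod_pi (@sub_trace i)) submod_traceE xK; congr negb.
by rewrite eqn_pmul2l ?expn_gt0 // eqSS eqn_pmul2l.
Qed.

End Chain.

Lemma dual_system_no_krull_dim (M : lmodType S) (x : nat -> M) K :
  dual_system x K -> ~ has_krull_dim M.
Proof.
move=> xK [/(dual_system_nonzero xK) //|[W [a]]].
(* The module varies in the induction, since the hypothesis is applied to a factor. *)
elim/(well_founded_ind (@wo_wf W)): a M x K xK => a IH M x K xK.
rewrite krull_dim_isE => -[_ [[_]|[_ _ dimM]]].
  exact: dual_system_not_artinian xK.
have [k] := dimM _ (@dyadic_cap_chain M K).
have [y [K' yK']] := dual_system_factor xK k.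
(* One factor suffices: it is neither zero nor, by induction, of smaller dimension. *)
case/(_ k (leqnn k)) => [|[b [ltba dimF]]].
  exact: dual_system_nonzero yK'.
exact: IH ltba _ _ _ yK' dimF.
Qed.

End DualSystem.

(** * Decreasing idempotents and left Krull dimension *)

Section OrthogonalIdempotents.
Variable S : pzRingType.

Definition left_annihilator (s : S) : {pred S^o} := fun z => (z : S) * s == 0.

Lemma left_annihilatorE s (z : S^o) :
  (z \in left_annihilator s) = ((z : S) * s == 0).
Proof. by []. Qed.

Lemma left_annihilator_closed s : subsemimod_closed (left_annihilator s).
Proof.
split; first split.
- by rewrite left_annihilatorE mul0r.
- move=> y z; rewrite !left_annihilatorE => /eqP ys0 /eqP zs0.
  by rewrite mulrDl ys0 zs0 addr0.
- move=> a z; rewrite !left_annihilatorE => /eqP zs0.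
  by rewrite -mulrA zs0 mulr0.
Qed.

HB.instance Definition _ s :=
  GRing.isSubSemiModClosed.Build S S^o (left_annihilator s)
    (left_annihilator_closed s).

(** The differences [g k] of successive terms are nonzero orthogonal idempotents; since [g j * g i]
    vanishes exactly when [j != i], they form a dual system with their left annihilators. *)
Lemma decreasing_idempotents_no_krull_dim (e : nat -> S) :
  (forall k, e k * e k = e k) ->
  (forall k, e k * e k.+1 = e k.+1) -> (forall k, e k.+1 * e k = e k.+1) ->
  (forall k, e k != e k.+1) ->
  ~ has_left_krull_dim S.
Proof.
move=> e_idem eSr eSl e_neq.
have eDr k d : e k * e (d + k)%N = e (d + k)%N.
  elim: d => [|d IHd]; first exact: e_idem.
  by rewrite addSn -[in LHS]eSr mulrA IHd eSr.
have eDl k d : e (d + k)%N * e k = e (d + k)%N.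
  elim: d => [|d IHd]; first exact: e_idem.
  by rewrite addSn -[in LHS]eSl -mulrA IHd eSl.
(* Of two terms of the sequence, the product in either order is the later one. *)
have eM j k : e j * e k = e (maxn j k).
  have [le_jk|/ltnW le_kj] := leqP j k; first by rewrite -(subnK le_jk) eDr.
  by rewrite -(subnK le_kj) eDl.
pose g k : S := e k - e k.+1.
have gM j k : g j * g k = if j == k then g k else 0.
  rewrite mulrBl !mulrBr !eM; case: ltngtP => [lt_jk|lt_kj|->].
  - have -> : maxn j k.+1 = k.+1 by lia.
    have -> : maxn j.+1 k = k by lia.
    have -> : maxn j.+1 k.+1 = k.+1 by lia.
    by rewrite subrr.
  - have -> : maxn j k.+1 = j by lia.
    have -> : maxn j.+1 k = j.+1 by lia.
    have -> : maxn j.+1 k.+1 = j.+1 by lia.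
    by rewrite !subrr.
  - have -> : maxn k k.+1 = k.+1 by lia.
    have -> : maxn k.+1 k = k.+1 by lia.
    by rewrite !maxnn subrr subr0.
have g_neq0 k : g k != 0 by rewrite subr_eq0.
apply: (@dual_system_no_krull_dim S S^o g (fun k => left_annihilator (g k))).
move=> i j; rewrite left_annihilatorE gM; case: ifP => _; last by rewrite eqxx.
exact: negbTE.
Qed.

End OrthogonalIdempotents.

(** Equal images agree after [d] and [e] steps; comparing levels gives [d = e], and the steps are
    then cancelled one by one. *)
Lemma dirlim_in_inj (A : nat -> pzRingType) (f : forall k, {rmorphism A k -> A k.+1}) :
  (forall k, injective (f k)) ->
  forall k, injective (@dirlim_in A f k).
Proof.
move=> f_inj k a b /dirlim_inP[d [e]] E.
have eq_de : d = e by have := congr1 tag E; rewrite !tag_iter_dirlim => /addIn.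
move: E; rewrite {}eq_de !iter_dirlim_step => /eqP; rewrite eq_Tagged => /eqP /=.
by elim: e => //= e IHe /f_inj.
Qed.

(** * Block diagonal matrices and corner matrix units *)

Section BlockDiagonal.
Variables (n : nat) (R : pzRingType).

Definition block_diag k (A : 'I_n -> 'M[R]_(n ^ k)) : 'M[R]_(n ^ k.+1) :=
  castmx (sum_block_size n k, sum_block_size n k) (\mxdiag_(i < n) A i).

Lemma block_diagM k (A B : 'I_n -> 'M[R]_(n ^ k)) :
  block_diag A * block_diag B = block_diag (fun i => A i * B i).
Proof.
rewrite /block_diag; move: (sum_block_size n k) => e.
have -> : \mxdiag_(i < n) (A i * B i) = \mxdiag_(i < n) A i *m \mxdiag_(i < n) B i.
  rewrite {3}/mxdiag mul_mxdiag_mxblock; apply/eq_mxblock => i j.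
  by case: eqP => [->|_]; rewrite ?conform_mx_id ?mulmx0.
by case: _ / e; rewrite !castmx_id.
Qed.

Lemma block_diag_inj k (A B : 'I_n -> 'M[R]_(n ^ k)) :
  block_diag A = block_diag B -> A =1 B.
Proof.
rewrite /block_diag; move: (sum_block_size n k) => e.
by case: _ / e; rewrite !castmx_id => /eq_mxdiagP.
Qed.

Lemma diag_embedE k (A : 'M[R]_(n ^ k)) : diag_embed A = block_diag (fun=> A).
Proof. by []. Qed.

(** The matrix unit with 1 in the top left corner, built by nested blocks so that its products with
    [diag_embed] are computed blockwise. *)
Fixpoint corner_unit k : 'M[R]_(n ^ k) :=
  if k is k'.+1 then
    block_diag (fun i => if val i == 0%N then corner_unit k' else 0)
  else 1.

Lemma corner_unit_idem k : corner_unit k * corner_unit k = corner_unit k.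
Proof.
elim: k => [|k IHk] /=; first by rewrite mulr1.
rewrite block_diagM; congr block_diag; apply/funext => i.
by case: ifP; rewrite ?mulr0.
Qed.

Lemma embed_mul_corner_unit k :
  diag_embed (corner_unit k) * corner_unit k.+1 = corner_unit k.+1.
Proof.
rewrite diag_embedE block_diagM; congr block_diag; apply/funext => i.
by case: ifP; rewrite ?mulr0 ?corner_unit_idem.
Qed.

Lemma corner_unit_mul_embed k :
  corner_unit k.+1 * diag_embed (corner_unit k) = corner_unit k.+1.
Proof.
rewrite diag_embedE block_diagM; congr block_diag; apply/funext => i.
by case: ifP; rewrite ?mul0r ?corner_unit_idem.
Qed.

End BlockDiagonal.

Lemma corner_unit_neq0 (n : nat) (R : nzRingType) k :
  (0 < n)%N -> corner_unit n R k != 0.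
Proof.
move=> n_gt0; elim: k => [|k] /=.
  by apply/eqP => /matrixP/(_ 0 0)/eqP; rewrite !mxE eqxx oner_eq0.
apply: contra => /eqP E; apply/eqP.
(* Writing 0 as a block diagonal matrix allows the first blocks to be compared. *)
have : @block_diag n R k (fun=> 0) = 0 by rewrite -diag_embedE raddf0.
by rewrite -E => /block_diag_inj/(_ (Ordinal n_gt0)).
Qed.

Unset Implicit Arguments.

Theorem corollary9 (n : nat) (R : nzRingType) (n_gt1 : (1 < n)%N) :
  ~ has_left_krull_dim (matricial_closure n R).
Proof.
have n_gt0 := ltnW n_gt1.
have embed_inj k : injective (@diag_embed n R k).
  by move=> A B; rewrite !diag_embedE => /block_diag_inj/(_ (Ordinal n_gt0)).
pose f k : {rmorphism 'M[R]_(n ^ k) -> 'M[R]_(n ^ k.+1)} := @diag_embed n R k.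
pose u k : matricial_closure n R := dirlim_in f (corner_unit n R k).
(* Raising [u k] one level puts it in the same matrix ring as the representative of [u k.+1]. *)
have uS k : u k = dirlim_in f (diag_embed (corner_unit n R k)).
  by rewrite [RHS]dirlim_in_step.
apply: (@decreasing_idempotents_no_krull_dim (matricial_closure n R) u) => k.
- by rewrite /u -rmorphM corner_unit_idem.
- by rewrite (uS k) /u -rmorphM embed_mul_corner_unit.
- by rewrite (uS k) /u -rmorphM corner_unit_mul_embed.
- rewrite uS; apply: contra (corner_unit_neq0 R k n_gt0).
  (* The second block, present because [1 < n], is [corner_unit n R k] on one side and 0 on the
     other; for [n = 1] all [u k] would be 1. *)
  by move=> /eqP /(@dirlim_in_inj _ f embed_inj) /block_diag_inj/(_ (Ordinal n_gt1)) ->.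
Qed.
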